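(* Let $R$ be a Dedekind domain with fraction field $K$, let $R[x]=R[x_1,\dots,x_n]$ be equipped with a monomial ordering $<$, let $I$ be an ideal of $R[x]$ and let $G=\{(g_i,\mathfrak g_i)\mid 1\le i\le l\}$ be a finite set of non-zero pseudo-polynomials of $I$. Then the following are equivalent: (i) $\operatorname{Lt}(I)=\operatorname{Lt}(G)$. (ii) For every pseudo-polynomial $(f,\mathfrak f)$ of $R[x]$ we have $\langle(f,\mathfrak f)\rangle\subseteq I$ if and only if $(f,\mathfrak f)$ reduces to $(0,\mathfrak f)$ modulo $G$. (iii) For every non-zero pseudo-polynomial $(f,\mathfrak f)$ of $R[x]$ with $\langle(f,\mathfrak f)\rangle\subseteq I$ there exist $h_i\in(\mathfrak g_i\mathfrak f^{-1})[x]$, $1\le i\le l$, such that $f=\sum_{i=1}^l h_ig_i$ and $\operatorname{lm}(f)=\max\{\operatorname{lm}(h_ig_i)\mid 1\le i\le l,\ h_i\ne 0\}$. (iv) Whenever $(a_{ij})_{1\le j\le n_i}$ are generators of the fractional ideal $\mathfrak g_i$ for $1\le i\le l$, the set $\{a_{ij}g_i\mid 1\le i\le l,\ 1\le j\le n_i\}$ is a Gröbner basis of $I$.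
   Context: A Dedekind domain is a Noetherian integrally closed domain of Krull dimension one. A monomial ordering is a total well-ordering on monomials compatible with multiplication. For non-zero $f=\sum_\alpha c_\alpha x^\alpha\in K[x]$, $\deg(f)\in\mathbb N^n$ is the largest exponent $\alpha$ (with respect to $<$) with $c_\alpha\ne0$; $\operatorname{lm}(f)=x^{\deg(f)}$, $\operatorname{lc}(f)=c_{\deg(f)}$, $\operatorname{lt}(f)=\operatorname{lc}(f)\operatorname{lm}(f)$. A fractional ideal of $R$ is a non-zero finitely generated $R$-submodule of $K$; for a fractional ideal $\mathfrak a$, $\mathfrak a[x]$ is the set of polynomials in $K[x]$ with all coefficients in $\mathfrak a$. A pseudo-polynomial of $R[x]$ is a pair $(f,\mathfrak f)$ with $f\in K[x]$ and $\mathfrak f$ a fractional ideal of $R$ such that $\mathfrak f f\subseteq R[x]$; it is zero if $f=0$. Put $\operatorname{lc}(f,\mathfrak f)=\mathfrak f\operatorname{lc}(f)$ and $\langle(f,\mathfrak f)\rangle=\mathfrak f[x]f$, an ideal of $R[x]$. A pseudo-polynomial of $I$ is one with $\langle(f,\mathfrak f)\rangle\subseteq I$. Reduction: let $(f,\mathfrak f)$ be a non-zero pseudo-polynomial and $J=\{i\mid \operatorname{lm}(g_i)\text{ divides }\operatorname{lm}(f)\}$. It can be reduced modulo $G$ if $\operatorname{lc}(f,\mathfrak f)\subseteq\sum_{i\in J}\operatorname{lc}(g_i,\mathfrak g_i)$; equivalently, there exist $a_i\in\mathfrak g_i\mathfrak f^{-1}$, $i\in J$, with $\operatorname{lc}(f)=\sum_{i\in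 J}a_i\operatorname{lc}(g_i)$. For any such choice of $(a_i)_{i\in J}$, the pair $(f-\sum_{i\in J}a_ix^{\deg(f)-\deg(g_i)}g_i,\ \mathfrak f)$ is called a one step reduction of $(f,\mathfrak f)$ with respect to $G$. We say that $(f,\mathfrak f)$ reduces to $(h,\mathfrak f)$ modulo $G$ if $(h,\mathfrak f)$ is obtained from $(f,\mathfrak f)$ by a finite (possibly empty) chain of one step reductions with respect to $G$; here $h=0$ is allowed. Leading term ideals: $\operatorname{Lt}(g,\mathfrak g)=\mathfrak g[x]\operatorname{lt}(g)$ for a non-zero pseudo-polynomial, $\operatorname{Lt}(G)=\sum_{i=1}^l\operatorname{Lt}(g_i,\mathfrak g_i)$, and for a set $F\subseteq R[x]$ of polynomials $\operatorname{Lt}(F)$ is the ideal of $R[x]$ generated by $\operatorname{lt}(f)$ for non-zero $f\in F$. A finite set $F\subseteq I$ is a Gröbner basis of $I$ if $\operatorname{Lt}(F)=\operatorname{Lt}(I)$. *)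

(* Defs.v *)
From HB Require Import structures.
From mathcomp Require Import all_boot all_order all_algebra.
From mathcomp Require Import boolp classical_sets functions cardinality.
From mathcomp Require Import mpoly.
From Stdlib Require Import Relation_Operators.

Set Implicit Arguments.
Unset Strict Implicit.
Unset Printing Implicit Defensive.

Import GRing.Theory.
Local Open Scope classical_set_scope.
Local Open Scope ring_scope.

Section Submodules.
Variable A : comNzRingType.

(* [S] plays the role of a subring of [A]: we use [S = setT] for the ideals of
   [A], [S = range tofrac] for the R-submodules of Frac R, and
   [S = polyset (range tofrac)] for the ideals of R[x] inside K[x]. *)
Definition submodule_over (S M : set A) : Prop :=
  [/\ M 0, (forall x y, M x -> M y -> M (x + y))
    & forall a x, S a -> M x -> M (a * x)].

Definition generated_over (S X : set A) : set A :=
  smallest (submodule_over S) X.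

Definition ideal_of (S J : set A) : Prop := submodule_over S J /\ J `<=` S.

Definition noetherian : Prop :=
  forall J, ideal_of setT J ->
    exists s : seq A, J = generated_over setT [set` s].

Definition prime_ideal (P : set A) : Prop :=
  [/\ ideal_of setT P, ~ P 1 & forall x y, P (x * y) -> P x \/ P y].

Definition prime_chain (d : nat) (P : nat -> set A) : Prop :=
  (forall i, (i <= d)%N -> prime_ideal (P i)) /\
  (forall i, (i < d)%N -> P i `<` P i.+1).

Definition krull_dimension (d : nat) : Prop :=
  (exists P, prime_chain d P) /\
  (forall e P, prime_chain e P -> (e <= d)%N).

End Submodules.

Section FractionalIdeals.
Variable R : idomainType.
Local Notation K := {fraction R}.

(* The ring R as a subset of its fraction field. *)
Definition Rset : set K := range (@FracField.tofrac R).

Definition integrally_closed : Prop :=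
  forall z : K, integralOver (@FracField.tofrac R) z -> Rset z.

Definition dedekind : Prop :=
  [/\ noetherian R, integrally_closed & krull_dimension R 1].

Definition fractional_ideal (a : set K) : Prop :=
  (exists2 x, a x & x != 0) /\
  (exists s : seq K, a = generated_over Rset [set` s]).

Definition fracM (a b : set K) : set K :=
  generated_over Rset [set z | exists x y, [/\ a x, b y & z = x * y]].

Definition fracV (a : set K) : set K :=
  [set x | forall y, a y -> Rset (x * y)].

End FractionalIdeals.

Section MonomialOrder.
Variable n : nat.

(* A monomial x^m is represented by its exponent [m : 'X_{1..n}], so that the
   product of monomials is the sum of exponents. *)
Definition monomial_order (le : rel 'X_{1..n}) : Prop :=
  [/\ total le, antisymmetric le, transitive le,
      well_founded (fun m1 m2 => le m1 m2 && (m1 != m2))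
    & forall m m1 m2, le m1 m2 -> le (m + m1)%MM (m + m2)%MM].

End MonomialOrder.

Section LeadingTerms.
Variables (n : nat) (K : fieldType) (le : rel 'X_{1..n}).
Implicit Types f : {mpoly K[n]}.

(* The order built in the library ([mlead]) is a fixed one, hence the
   following; the default value 0 is only taken by [f = 0]. *)
Definition ldeg f : 'X_{1..n} := last 0%MM (sort le (msupp f)).
Definition lcoef f : K := f@_(ldeg f).
Definition lterm f : {mpoly K[n]} := lcoef f *: 'X_[ldeg f].

Lemma ldegP f : monomial_order le -> f != 0 ->
  ldeg f \in msupp f /\ (forall m, m \in msupp f -> le m (ldeg f)).
Proof.
move=> [le_total _ le_trans _ _] f0; rewrite /ldeg.
have refl m : le m m by have := le_total m m; rewrite orbb.
have s0 : sort le (msupp f) != [::].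
  by rewrite -size_eq0 size_sort size_eq0 msupp_eq0.
have memE := mem_sort le (msupp f).
have sortE := sort_sorted le_total (msupp f).
case: (lastP (sort le (msupp f))) s0 memE sortE => // s x _ memE sortE.
rewrite last_rcons; split=> [|m]; rewrite -memE ?mem_rcons ?mem_head //.
rewrite inE => /predU1P[-> //|ms].
move: sortE; rewrite (sorted_pairwise le_trans) -cats1 pairwise_cat.
by case/andP=> /allrelP/(_ m x ms); rewrite inE => /(_ (eqxx x)).
Qed.

End LeadingTerms.

Section PseudoPolynomials.
Variables (n : nat) (R : idomainType) (le : rel 'X_{1..n}).
Local Notation K := {fraction R}.
Local Notation Kx := {mpoly K[n]}.

(* The set a[x] of polynomials with coefficients in a. *)
Definition polyset (a : set K) : set Kx := [set p | forall m, a p@_m].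

(* R[x] as a subset of K[x]. *)
Definition Rxset : set Kx := polyset (@Rset R).

(* In this section the pair (f, ff) is given by its two components. *)
Definition pseudo_poly (f : Kx) (ff : set K) : Prop :=
  fractional_ideal ff /\ (forall c, ff c -> Rxset (c *: f)).

Definition pseudo_span (f : Kx) (ff : set K) : set Kx :=
  [set p * f | p in polyset ff].

Definition lt_set (F : set Kx) : set Kx :=
  generated_over Rxset [set lterm le f | f in [set f | F f /\ f != 0]].

Definition lt_pseudo (g : Kx) (gg : set K) : set Kx :=
  [set p * lterm le g | p in polyset gg].

Definition groebner_basis (I F : set Kx) : Prop :=
  [/\ finite_set F, F `<=` I & lt_set F = lt_set I].

Variables (l : nat) (g : 'I_l -> Kx) (gg : 'I_l -> set K).

(* The sum of the ideals Lt(g_i, gg_i). *)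
Definition lt_family : set Kx :=
  [set \sum_i q i | q in [set q | forall i, lt_pseudo (g i) (gg i) (q i)]].

Definition divides_lm (f : Kx) : pred 'I_l :=
  fun i => (ldeg le (g i) <= ldeg le f)%MM.

(* (h, ff) is a one step reduction of (f, ff). *)
Definition one_step_reduction (ff : set K) (f h : Kx) : Prop :=
  f != 0 /\
  exists a : 'I_l -> K,
    [/\ forall i, divides_lm f i -> fracM (gg i) (fracV ff) (a i),
        lcoef le f = \sum_(i | divides_lm f i) a i * lcoef le (g i)
      & h = f - \sum_(i | divides_lm f i)
                  a i *: 'X_[ldeg le f - ldeg le (g i)] * g i].

(* (f, ff) reduces to (h, ff). *)
Definition reduces_to (ff : set K) : Kx -> Kx -> Prop :=
  clos_refl_trans_1n Kx (one_step_reduction ff).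

End PseudoPolynomials.

(* Main.v *)
(** A fractional ideal ff of a Dedekind domain R is invertible. Otherwise
    M = ff ff^-1 is a proper non-zero ideal of R. It lies in a prime ideal P;
    for a non-zero a in M, a maximal element among the ideals ((a) : b) lying in
    P is prime, hence equal to P as R has dimension one, and x = b / a
    satisfies x M <= R with x not in R. But x M <= R gives x ff^-1 <= ff^-1, so
    x M <= M, so x is integral over R, a contradiction.

    (i) => (ii): if ff f lies in I then ff lc(f) is contained in the sum of the
    gg_i lc(g_i) with lm(g_i) dividing lm(f), and since ff is invertible (f, ff)
    can be reduced; the leading monomial decreases, so the process stops at 0.
    (ii) => (iii): the coefficients used along a chain of reductions add up to
    the h_i. (iii) => (iv): apply (iii) with ff = R and read off the leading
    terms. (iv) => (i): the leading terms of the a_ij g_i generate Lt(G). *)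

Require Import Defs.
From mathcomp Require Import all_boot all_order all_algebra.
From mathcomp Require Import boolp classical_sets functions cardinality.
From mathcomp Require Import mpoly ring.
From Stdlib Require Import Relation_Operators.

Set Implicit Arguments.
Unset Strict Implicit.
Unset Printing Implicit Defensive.

Import GRing.Theory.
Local Open Scope classical_set_scope.
Local Open Scope ring_scope.

(** * Maximal and prime ideals of Noetherian rings *)

Section Submodules.
Variable A : comNzRingType.
Implicit Types (S M X P J : set A) (s : seq A).

Lemma submodule_generated S X : submodule_over S (generated_over S X).
Proof.
split=> [N [[]]|x y Mx My N [subN XN]|a x Sa Mx N [subN XN]] //.
- by case: (subN) => _ + _; apply; [apply: Mx|apply: My].
- by case: (subN) => _ _; apply=> //; apply: Mx.
Qed.

Lemma submodule_sum S M (J : Type) (r : seq J) (P : pred J) (F : J -> A) :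
  submodule_over S M -> (forall j, P j -> M (F j)) ->
  M (\sum_(j <- r | P j) F j).
Proof. by case=> M0 MD _ MF; apply: (big_ind M). Qed.

Lemma generated_lincomb s x : generated_over setT [set` s] x ->
  exists c : 'I_(size s) -> A, x = \sum_i c i * s`_i.
Proof.
pose N := [set x | exists c : 'I_(size s) -> A, x = \sum_i c i * s`_i].
apply: (@smallest_sub _ (submodule_over setT) [set` s] N) => [|y /= ys].
  split=> [|_ _ [c ->] [d ->]|a _ _ [c ->]].
  - by exists (fun=> 0); rewrite big1 // => i _; rewrite mul0r.
  - exists (fun i => c i + d i).
    by rewrite -big_split; apply: eq_bigr => i _; rewrite mulrDl.
  - exists (fun i => a * c i).
    by rewrite mulr_sumr; apply: eq_bigr => i _; rewrite mulrA.
have ilt : (index y s < size s)%N by rewrite index_mem.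
exists (fun i => (i == Ordinal ilt)%:R).
rewrite (bigD1 (Ordinal ilt)) //= eqxx mul1r nth_index // big1 ?addr0 //.
by move=> i /negPf ->; rewrite mul0r.
Qed.

(* The union of a strictly increasing chain is finitely generated, hence
   already equal to one of its terms. *)
Lemma noetherian_maximal (F : set (set A)) J0 : noetherian A ->
    (forall J, F J -> submodule_over setT J) -> F J0 ->
  exists2 J, F J & forall J', F J' -> J `<=` J' -> J' `<=` J.
Proof.
move=> noeth Fid FJ0; apply: contrapT => noMax.
(* The premise [F J] stands under the existential so that [next] is total; outside [F] its value is
   arbitrary. *)
have /choice[next nextP] J : exists J', F J ->
    [/\ F J', J `<=` J' & ~ (J' `<=` J)].
  have [FJ|nFJ] := EM (F J); last by exists J.
  apply: contrapT => noJ'; apply: noMax; exists J => // J' FJ' JJ'.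
  by apply: contrapT => nJ'J; apply: noJ'; exists J'.
pose C k := iter k next J0.
have FC k : F (C k) by elim: k => //= k /nextP[].
have CS k : C k `<=` C k.+1 by case: (nextP _ (FC k)).
have Cle i j : (i <= j)%N -> C i `<=` C j.
  move=> /subnKC <-; elim: (j - i)%N => [|k IH]; first by rewrite addn0.
  by rewrite addnS; apply: subset_trans (CS _).
pose U := [set x | exists k, C k x].
have Uid : submodule_over setT U.
  split=> [|x y [i Cx] [j Cy]|a x _ [i Cx]].
  - by exists 0; case: (Fid _ (FC 0)).
  - exists (maxn i j); case: (Fid _ (FC (maxn i j))) => _ CD _.
    apply: CD; first by apply: Cle Cx; apply: leq_maxl.
    by apply: Cle Cy; apply: leq_maxr.
  - by exists i; case: (Fid _ (FC i)) => _ _; apply.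
have [s Us] := noeth U (conj Uid (@subsetT _ _)).
have [k sk] : exists k, [set` s] `<=` C k.
  have : [set` s] `<=` U by rewrite Us; apply: sub_gen_smallest.
  elim: s {Us} => [|x s IH] sU; first by exists 0.
  have [|k sk] := IH.
    by move=> y /= ys; apply: sU; rewrite /= inE ys orbT.
  have [j Cx] := sU x (mem_head x s).
  exists (maxn j k) => y /=; rewrite inE => /predU1P[->|ys].
    by apply: Cle Cx; apply: leq_maxl.
  by apply: (Cle k); [apply: leq_maxr|apply: sk].
have UC : U `<=` C k by rewrite Us; apply: smallest_sub; first exact: Fid.
have [_ _] := nextP _ (FC k); apply=> x Cx; apply: UC.
by exists k.+1.
Qed.

(** If x is not in P, then P + (x) contains 1; multiplying 1 = p + r x by y puts y in P. *)
Lemma maximal_ideal_prime P : submodule_over setT P -> ~ P 1 ->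
    (forall J, submodule_over setT J -> ~ J 1 -> P `<=` J -> J `<=` P) ->
  prime_ideal P.
Proof.
move=> Pid P1 Pmax; have [P0 PD PM] := Pid; split=> // x y Pxy.
have [Px|nPx] := EM (P x); [by left|right].
pose J := [set z | exists p r, P p /\ z = p + r * x].
have Jid : submodule_over setT J.
  split=> [|_ _ [p [r [Pp ->]]] [q [t [Pq ->]]]|a _ _ [p [r [Pp ->]]]].
  - by exists 0, 0; rewrite mul0r addr0.
  - by exists (p + q), (r + t); rewrite mulrDl addrACA; split=> //; apply: PD.
  - by exists (a * p), (a * r); rewrite mulrDr mulrA; split=> //; apply: PM.
have PJ : P `<=` J by move=> p Pp; exists p, 0; rewrite mul0r addr0.
have [[p [r [Pp def1]]]|nJ1] := EM (J 1).
  rewrite -[y]mul1r def1 mulrDl -mulrA; apply: PD; last exact: PM.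
  by rewrite mulrC; apply: PM.
by case: nPx; apply: (Pmax _ Jid nJ1 PJ); exists 0, 1; rewrite mul1r add0r.
Qed.

(** The Noetherian property, in place of Zorn's lemma, provides a maximal proper ideal above M. *)
Lemma proper_ideal_sub_prime M : noetherian A -> submodule_over setT M ->
  ~ M 1 -> exists2 P, prime_ideal P & M `<=` P.
Proof.
move=> noeth Mid M1.
pose F := [set J | [/\ submodule_over setT J, ~ J 1 & M `<=` J]].
have FM : F M by split; [|exact: M1|].
have [|P [Pid P1 MP] Pmax] := noetherian_maximal noeth _ FM.
  by move=> J [].
exists P => //; apply: maximal_ideal_prime => // J Jid J1 PJ.
by apply: (Pmax J _ PJ); split=> //; apply: subset_trans MP PJ.
Qed.

(* A maximal element among the ideals ((a) : b) contained in P is prime; this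
   plays the role of an associated prime of A/(a) localized at P. *)
Lemma prime_colon_sub_prime P a : noetherian A -> prime_ideal P -> P a ->
  exists b, let Q := [set z | exists t, z * b = t * a] in
    prime_ideal Q /\ Q `<=` P.
Proof.
move=> noeth [[[P0 PD PM] _] P1 Pprime] Pa.
pose Q b := [set z | exists t, z * b = t * a].
have Qid b : submodule_over setT (Q b).
  split=> [|x y [t xb] [u yb]|c x _ [t xb]].
  - by exists 0; rewrite !mul0r.
  - by exists (t + u); rewrite !mulrDl xb yb.
  - by exists (c * t); rewrite -!mulrA xb.
pose F := [set J | exists2 b, J = Q b & Q b `<=` P].
(* The family is non-empty: ((a) : 1) = (a) lies in P. *)
have FQ1 : F (Q 1).
  by exists 1 => // z [t]; rewrite mulr1 => ->; apply: PM.
have [|_ [b -> QP] Qmax] := noetherian_maximal noeth _ FQ1.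
  by move=> _ [b -> _].
exists b; split=> //; split; [by split; first exact: (Qid b)|by move/QP|].
move=> x y Qxy; have [Qy|nQy] := EM (Q b y); [by right|left].
have QQ c : Q b `<=` Q (b * c).
  by move=> z [t zb]; exists (t * c); rewrite mulrA zb mulrAC.
(* y lies in ((a) : b x); if that ideal lay in P, maximality would put y in ((a) : b). *)
have [s Qs nPs] : exists2 s, Q (b * x) s & ~ P s.
  apply: contrapT => nexs; apply: nQy; apply: (Qmax (Q (b * x))).
  - by exists (b * x) => // s Qs; apply: contrapT => nPs; apply: nexs; exists s.
  - exact: QQ.
  - by case: Qxy => t xyb; exists t; rewrite -xyb; ring.
(* If u is in ((a) : b s), then u s is in ((a) : b), hence in P, so u is in P. Maximality then gives
   ((a) : b s) = ((a) : b), and x is in the former by the choice of s. *)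
apply: (Qmax (Q (b * s))).
- exists (b * s) => // u [t ubs]; have : P (u * s).
    by apply: QP; exists t; rewrite -ubs -mulrA [s * b]mulrC.
  by case/Pprime.
- exact: QQ.
- by case: Qs => t sbx; exists t; rewrite -sbx; ring.
Qed.

End Submodules.

(** * Fractional ideals and their invertibility over a Dedekind domain *)

Section FractionalIdeals.
Variable R : idomainType.
Local Notation K := {fraction R}.
Local Notation tofrac := (@FracField.tofrac R).
Implicit Types (a b ff M : set K) (x y z : K).

Lemma Rset_tofrac (r : R) : Rset (tofrac r).
Proof. by exists r. Qed.

Lemma Rset0 : Rset (0 : K).
Proof. by exists 0; rewrite ?rmorph0. Qed.

Lemma Rset1 : Rset (1 : K).
Proof. by exists 1; rewrite ?rmorph1. Qed.

Lemma RsetD x y : Rset x -> Rset y -> Rset (x + y).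
Proof. by move=> [r _ <-] [t _ <-]; exists (r + t); rewrite ?rmorphD. Qed.

Lemma RsetM x y : Rset x -> Rset y -> Rset (x * y).
Proof. by move=> [r _ <-] [t _ <-]; exists (r * t); rewrite ?rmorphM. Qed.

Lemma fractional_submodule ff :
  fractional_ideal ff -> submodule_over (@Rset R) ff.
Proof. by case=> _ [s ->]; apply: submodule_generated. Qed.

Lemma fracM_submodule a b : submodule_over (@Rset R) (fracM a b).
Proof. exact: submodule_generated. Qed.

Lemma fracM_mem a b x y : a x -> b y -> fracM a b (x * y).
Proof. by move=> ax b_y; apply: sub_gen_smallest; exists x, y. Qed.

Lemma fracM_sub a b M : submodule_over (@Rset R) M ->
  (forall x y, a x -> b y -> M (x * y)) -> fracM a b `<=` M.
Proof.
by move=> Mmod abM; apply: smallest_sub => // _ [x [y [ax b_y ->]]]; apply: abM.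
Qed.

Lemma Rset_submodule : submodule_over (@Rset R) (@Rset R).
Proof. by split; [apply: Rset0|apply: RsetD|apply: RsetM]. Qed.

Lemma fracM_fracV_sub ff : fracM ff (fracV ff) `<=` @Rset R.
Proof.
apply: fracM_sub Rset_submodule _ => x y fx Vy.
by rewrite mulrC; apply: Vy.
Qed.

(** For x = u v with u in a and v in ff^-1, the factor y v lies in R, so y x = u (y v) lies in a;
    the general x follows by linearity. *)
Lemma fracVM_mul a ff x y : submodule_over (@Rset R) a ->
  fracM a (fracV ff) x -> ff y -> a (y * x).
Proof.
move=> amod ax fy; move: x ax.
apply: (@fracM_sub a (fracV ff) [set x | a (y * x)]) => [|u v au Vv].
  have [a0 aD aM] := amod; split=> [|u v au av|c u Rc au] /=.
  - by rewrite mulr0.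
  - by rewrite mulrDr; apply: aD.
  - by rewrite mulrCA; apply: aM.
case: amod => _ _ aM; rewrite /= mulrCA mulrC; apply: aM => //.
by rewrite mulrC; apply: Vv.
Qed.

Lemma fractional_Rset : fractional_ideal (@Rset R).
Proof.
split; first by exists 1; [apply: Rset1|apply: oner_neq0].
exists [:: 1]; apply/seteqP; split=> [x Rx N [[_ _ NM] N1]|].
  by rewrite -[x]mulr1; apply: NM => //; apply: N1; apply: mem_head.
apply: smallest_sub Rset_submodule _ => x /=; rewrite inE => /eqP ->.
exact: Rset1.
Qed.

(** With this, the cofactors that (iii) gives for ff = R have their coefficients in gg_i. *)
Lemma fracM_fracV_Rset a : submodule_over (@Rset R) a ->
  fracM a (fracV (@Rset R)) `<=` a.
Proof.
by move=> amod x ax; rewrite -[x]mul1r; apply: fracVM_mul ax Rset1.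
Qed.

Lemma common_denominator (s : seq K) :
  exists2 d : R, d != 0 & {in s, forall x, Rset (tofrac d * x)}.
Proof.
elim: s => [|x s [d d0 ds]]; first by exists 1; rewrite ?oner_neq0.
have [m m0 Rm] : exists2 m : R, m != 0 & Rset (tofrac m * x).
  (* For a representative n / d of x, the equation d x = n is a cross-multiplication of ratios. *)
  elim/quotW: x => q; exists \d_q; first exact: denom_ratioP.
  exists \n_q => //; apply/esym; rewrite /tofrac; unlock FracField.tofrac.
  rewrite -[LHS]FracField.pi_mul; apply/eqP; rewrite FracField.equivf_def.
  rewrite /FracField.mulf !numden_Ratio ?mul1r ?mulr1 ?oner_neq0 //;
    by rewrite ?denom_ratioP // mulrC.
exists (d * m) => [|y]; first by rewrite mulf_neq0.
rewrite inE rmorphM => /predU1P[->|ys]; rewrite -?mulrA.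
  by apply: RsetM => //; apply: Rset_tofrac.
by rewrite mulrCA; apply: RsetM; [apply: Rset_tofrac|apply: ds].
Qed.

(** A common denominator of the generators of ff lies in ff^-1. *)
Lemma fracV_neq0 ff : fractional_ideal ff ->
  exists2 x, fracV ff x & x != 0.
Proof.
move=> [_ [s ->]]; have [d d0 ds] := common_denominator s.
exists (tofrac d); last by rewrite tofrac_eq0.
apply: (@smallest_sub _ _ _ [set y | Rset (tofrac d * y)]) => //.
split=> [|x y Rx Ry|c x Rc Rx] /=; first by rewrite mulr0; apply: Rset0.
- by rewrite mulrDr; apply: RsetD.
- by rewrite mulrCA; apply: RsetM.
Qed.

(* Cayley-Hamilton: x is an eigenvalue of a matrix over R. *)
Lemma stable_ideal_integral (M : set R) x : noetherian R ->
    submodule_over setT M -> (exists2 r, M r & r != 0) ->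
    (forall r, M r -> exists2 t, M t & x * tofrac r = tofrac t) ->
  integralOver tofrac x.
Proof.
move=> noeth Mid [r Mr r0] xM.
have [s Ms] := noeth M (conj Mid (@subsetT _ _)).
have lincomb t : M t -> exists c : 'I_(size s) -> R, t = \sum_i c i * s`_i.
  by rewrite Ms => /generated_lincomb.
have sM (i : 'I_(size s)) : M s`_i.
  by rewrite Ms; apply: sub_gen_smallest; apply: mem_nth.
have /choice[A defA] (i : 'I_(size s)) : exists c : 'I_(size s) -> R,
    x * tofrac s`_i = \sum_j tofrac (c j) * tofrac s`_j.
  have [t /lincomb[c ->] ->] := xM _ (sM i); exists c.
  by rewrite rmorph_sum; apply: eq_bigr => j _; rewrite rmorphM.
(* Transposed, because eigenvectors are rows: the row of generators times [B] is x times that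
   row. *)
pose B := \matrix_(i, j) A j i.
exists (char_poly B); first exact: char_poly_monic.
rewrite map_char_poly -eigenvalue_root_char; apply/eigenvalueP.
exists (\row_i tofrac s`_i).
  apply/rowP => j; rewrite !mxE defA; apply: eq_bigr => i _.
  by rewrite !mxE mulrC.
(* The eigenvector is not 0: otherwise all generators, and with them r, would vanish. *)
apply: contraNneq r0 => s0; have [c ->] := lincomb _ Mr.
rewrite big1 // => i _; have /rowP/(_ i) := s0; rewrite !mxE.
by move=> /eqP; rewrite tofrac_eq0 => /eqP ->; rewrite mulr0.
Qed.

Lemma prime_ideal0 : prime_ideal [set 0 : R].
Proof.
split; [split=> //|exact/eqP/oner_neq0|].
  by split=> [|_ _ -> ->|c _ _ ->] //=; rewrite ?addr0 ?mulr0.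
by move=> x y /eqP; rewrite mulf_eq0 => /orP[] /eqP; [left|right].
Qed.

(** Otherwise 0, Q, P would be a chain of primes of length 2. *)
Lemma dimension_one_prime (Q P : set R) : krull_dimension R 1 ->
    prime_ideal Q -> prime_ideal P -> (exists2 r, Q r & r != 0) -> Q `<=` P ->
  P `<=` Q.
Proof.
move=> [_ dim] Qp Pp [r Qr r0] QP; apply: contrapT => nPQ.
pose C k : set R := if k is k'.+1 then if k' is 0 then Q else P else [set 0].
suff /dim : prime_chain 2 C by [].
split=> [[|[|k]] _|[|[|//]] _] //=; first exact: prime_ideal0.
split=> [|/(_ r Qr) /= r_0]; last by rewrite r_0 eqxx in r0.
by move=> _ ->; case: Qp => [[[]]].
Qed.

Lemma dedekind_proper_ideal (M : set R) : dedekind R ->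
    submodule_over setT M -> ~ M 1 -> (exists2 r, M r & r != 0) ->
  exists2 x : K, ~ Rset x & forall r, M r -> Rset (x * tofrac r).
Proof.
move=> [noeth _ dim] Mid M1 [r Mr r0].
have [P Pprime MP] := proper_ideal_sub_prime noeth Mid M1.
have [b [Qprime QP]] := prime_colon_sub_prime noeth Pprime (MP _ Mr).
have rF : tofrac r != 0 by rewrite tofrac_eq0.
(* If b / r were in R, then b would be a multiple of r and 1 would lie in ((r) : b). *)
exists (tofrac b / tofrac r) => [[t _ def_t]|m Mm].
  case: Qprime => _ + _; apply; exists t; rewrite mul1r.
  by apply/eqP; rewrite -tofrac_eq rmorphM /= def_t divfK.
(* The prime ((r) : b) contains r, hence is non-zero and equal to P, which contains M. *)
have [t mb] : [set z | exists t, z * b = t * r] m.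
  apply: dimension_one_prime dim Qprime Pprime _ QP _ (MP _ Mm).
  by exists r => //; exists b; rewrite mulrC.
exists t => //; apply: (mulIf rF); rewrite -rmorphM /= -mb rmorphM /=.
by rewrite mulrAC divfK // mulrC.
Qed.

Lemma dedekind_invertible ff : dedekind R -> fractional_ideal ff ->
  fracM ff (fracV ff) 1.
Proof.
move=> ded frac; apply: contrapT => n1.
have [noeth intcl _] := ded.
(* Nothing is lost by passing to the preimage in R, as ff ff^-1 is contained in R. *)
pose M := [set r : R | fracM ff (fracV ff) (tofrac r)].
have [F0 FD FM] := fracM_submodule ff (fracV ff).
have Mid : submodule_over setT M.
  split=> [|r t Mr Mt|c r _ Mr]; rewrite /M /= ?rmorph0 ?rmorphD ?rmorphM //.
    exact: FD.
  by apply: FM => //; apply: Rset_tofrac.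
have M0 : exists2 r, M r & r != 0.
  have [y fy y0] := frac.1; have [z Vz z0] := fracV_neq0 frac.
  have Fyz := fracM_mem fy Vz; have [r _ def_r] := fracM_fracV_sub Fyz.
  exists r; first by rewrite /M /= def_r.
  by rewrite -tofrac_eq0 def_r mulf_neq0.
have [|x nRx xM] := dedekind_proper_ideal ded Mid _ M0.
  by rewrite /M /= rmorph1.
apply: nRx; apply: intcl; apply: stable_ideal_integral noeth Mid M0 _ => r Mr.
have Rxr := xM r Mr; case: (Rxr) => t _ def_t; exists t => //.
rewrite /M /= def_t.
suff /(_ _ Mr) : fracM ff (fracV ff) `<=`
  [set z | fracM ff (fracV ff) (x * z)] by [].
apply: fracM_sub => [|y z fy Vz] /=.
  split=> [|u v Fu Fv|c u Rc Fu] /=; rewrite ?mulr0 ?mulrDr ?(mulrCA x) //.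
    exact: FD.
  exact: FM.
(* x (y z) = y (x z), and x z stays in ff^-1: for w in ff the product w z comes from M, so x z w
   lies in R. *)
rewrite mulrCA; apply: fracM_mem => // w fw.
have Fwz := fracM_mem fw Vz; have [v _ def_v] := fracM_fracV_sub Fwz.
by rewrite -mulrA [z * w]mulrC -def_v; apply: xM; rewrite /M /= def_v.
Qed.

End FractionalIdeals.

(** * Supports and leading terms under the monomial ordering *)

Section SupportBounds.
Variables (n : nat) (K : fieldType) (le : rel 'X_{1..n}).
Hypothesis le_order : monomial_order le.
Implicit Types (f g p q : {mpoly K[n]}) (u v : 'X_{1..n}).

(** Unlike an equation for [ldeg], such a bound also makes sense for 0 and survives sums in which
    leading terms cancel. *)
Definition msupp_le p u := forall m, m \in msupp p -> le m u.

Let le_refl m : le m m.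
Proof. by case: le_order => /(_ m m); rewrite orbb. Qed.

Let le_anti m1 m2 : le m1 m2 -> le m2 m1 -> m1 = m2.
Proof. by case: le_order => _ anti _ _ _ le1 le2; apply: anti; rewrite le1. Qed.

Let le_trans m1 m2 m3 : le m1 m2 -> le m2 m3 -> le m1 m3.
Proof. by case: le_order => _ _ trans _ _; apply: trans. Qed.

Let le_add2l m m1 m2 : le m1 m2 -> le (m + m1)%MM (m + m2)%MM.
Proof. by case: le_order => _ _ _ _; apply. Qed.

Let le_add2r m m1 m2 : le m1 m2 -> le (m1 + m)%MM (m2 + m)%MM.
Proof. by rewrite ![(_ + m)%MM]addmC; apply: le_add2l. Qed.

Lemma msupp_le0 u : msupp_le 0 u.
Proof. by move=> m; rewrite msupp0. Qed.

Lemma msupp_leD p q u : msupp_le p u -> msupp_le q u -> msupp_le (p + q) u.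
Proof. by move=> pu qu m /msuppD_le; rewrite mem_cat => /orP[/pu|/qu]. Qed.

Lemma msupp_leN p u : msupp_le p u -> msupp_le (- p) u.
Proof. by move=> pu m; rewrite (perm_mem (msuppN p)) => /pu. Qed.

Lemma msupp_le_sum (J : finType) (P : pred J) (F : J -> {mpoly K[n]}) u :
  (forall j, P j -> msupp_le (F j) u) -> msupp_le (\sum_(j | P j) F j) u.
Proof.
by move=> Fu; apply: (big_ind (msupp_le^~ u)) => //;
  [apply: msupp_le0|move=> p q; apply: msupp_leD].
Qed.

Lemma msupp_leM p q u v :
  msupp_le p u -> msupp_le q v -> msupp_le (p * q) (u + v).
Proof.
move=> pu qv m /msuppM_le /allpairsP[[k1 k2] /= [k1p k2q ->]].
by apply: le_trans (le_add2l _ (qv _ k2q)); apply/le_add2r/pu.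
Qed.

Lemma msupp_leZX c u : msupp_le (c *: 'X_[u]) u.
Proof.
move=> m; rewrite mcoeff_msupp mcoeffZ mcoeffX.
by have [->|] := eqVneq u m; rewrite ?mulr0 ?eqxx.
Qed.

(** Only the pair (u, v) contributes: if m + k = u + v with m <= u and k <= v, then u + v <= m + v
    <= u + v, so m = u. When u or v is outside the support, both sides are 0. *)
Lemma mcoeffM_top p q u v : msupp_le p u -> msupp_le q v ->
  (p * q)@_(u + v) = p@_u * q@_v.
Proof.
move=> pu qv; rewrite {1}[p]mpolyE mulr_suml raddf_sum /=.
have coefE m : m \in msupp p ->
    (p@_m *: 'X_[m] * q)@_(u + v) = if m == u then p@_u * q@_v else 0.
  move=> mp; rewrite -scalerAl mcoeffZ mulrC [_ * q]mulrC.
  have [->|nmu] := eqVneq m u; first by rewrite mcoeffMX mulrC.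
  rewrite [X in X * _](_ : _ = 0) ?mul0r //; apply/memN_msupp_eq0.
  apply: contra nmu; rewrite (perm_mem (msuppMX _ _)) => /mapP[k kq] E.
  apply/eqP/le_anti; first exact: pu.
  have : le (u + v)%MM (m + v)%MM by rewrite E; apply/le_add2l/qv.
  move=> luv; suff /addIm -> : (u + v = m + v)%MM by [].
  by apply: le_anti => //; apply/le_add2r/pu.
rewrite big_seq (eq_bigr _ coefE) -big_seq.
have [up|nup] := boolP (u \in msupp p).
  rewrite (bigD1_seq u) ?msupp_uniq //= eqxx big1 ?addr0 // => m.
  by move/negPf ->.
rewrite memN_msupp_eq0 // mul0r big1 // => m _; exact: if_same.
Qed.

Lemma msupp_le_ldeg p : msupp_le p (ldeg le p).
Proof.
have [->|p0] := eqVneq p 0; first exact: msupp_le0.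
by case: (ldegP le_order p0).
Qed.

Lemma lcoef_neq0 p : p != 0 -> lcoef le p != 0.
Proof. by move=> p0; rewrite -mcoeff_msupp; case: (ldegP le_order p0). Qed.

Lemma ldeg_eq p u : p@_u != 0 -> msupp_le p u -> ldeg le p = u.
Proof.
move=> pu0 pu; have up : u \in msupp p by rewrite mcoeff_msupp.
have p0 : p != 0 by apply: contraNneq pu0 => ->; rewrite mcoeff0.
by apply: le_anti; [apply: pu; case: (ldegP le_order p0)|apply: msupp_le_ldeg].
Qed.

Lemma ldegZ c p : c != 0 -> ldeg le (c *: p) = ldeg le p.
Proof.
move=> c0; have [->|p0] := eqVneq p 0; first by rewrite scaler0.
apply: ldeg_eq; first by rewrite mcoeffZ mulf_neq0 // lcoef_neq0.
move=> m; rewrite mcoeff_msupp mcoeffZ mulf_eq0 negb_or => /andP[_ pm].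
by apply: msupp_le_ldeg; rewrite mcoeff_msupp.
Qed.

Lemma ltermZ c p : c != 0 -> lterm le (c *: p) = c *: lterm le p.
Proof. by move=> c0; rewrite /lterm /lcoef ldegZ // mcoeffZ scalerA. Qed.

Lemma msupp_le_trans p u v : msupp_le p u -> le u v -> msupp_le p v.
Proof. by move=> pu uv m /pu mu; apply: le_trans uv. Qed.

(** The leading exponent of p g is the sum of those of p and g. At this exponent the term is lt(p)
    lt(g); at any other bound u the coefficient is 0, and c = 0 with a dummy e will do. *)
Lemma top_termM (a : set K) p g u :
    g != 0 -> a 0 -> (forall m, a p@_m) -> msupp_le (p * g) u ->
  exists c, exists2 e, a c &
    (p * g)@_u *: 'X_[u] = c *: 'X_[e] * lterm le g.
Proof.
move=> g0 a0 ap pgu; have [->|p0] := eqVneq p 0.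
  by exists 0, 0%MM => //; rewrite mul0r mcoeff0 !scale0r mul0r.
pose d := (ldeg le p + ldeg le g)%MM.
have pgd : (p * g)@_d = lcoef le p * lcoef le g.
  by apply: mcoeffM_top; apply: msupp_le_ldeg.
have [->|nud] := eqVneq u d.
  exists (lcoef le p), (ldeg le p); first exact: ap.
  rewrite pgd mpolyXD /lterm -scalerAl -scalerAr scalerA //.
exists 0, 0%MM => //; rewrite scale0r mul0r memN_msupp_eq0 ?scale0r //.
apply: contra nud => u_pg; apply/eqP/le_anti.
  by apply: msupp_leM u_pg; apply: msupp_le_ldeg.
by apply: pgu; rewrite mcoeff_msupp pgd mulf_neq0 ?lcoef_neq0.
Qed.

End SupportBounds.

Lemma mcoeffMX_if n (K : nzRingType) (p : {mpoly K[n]}) (k m : 'X_{1..n}) :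
  (p * 'X_[k])@_m = if (k <= m)%MM then p@_(m - k) else 0.
Proof.
case: ifPn => [km|nkm]; first by rewrite -{1}(submK km) addmC mcoeffMX.
apply/memN_msupp_eq0; apply: contra nkm.
by rewrite (perm_mem (msuppMX _ _)) => /mapP[j _ ->]; apply: lem_addr.
Qed.

(** * Polynomials with coefficients in a given submodule of K *)

Section Polysets.
Variables (n : nat) (R : idomainType).
Local Notation K := {fraction R}.
Implicit Types (a b c : set K) (p q : {mpoly K[n]}).

Lemma polysetD a p q : submodule_over (@Rset R) a ->
  polyset a p -> polyset a q -> polyset a (p + q).
Proof. by move=> [_ aD _] ap aq m; rewrite mcoeffD; apply: aD. Qed.

Lemma polysetZX a x m : a 0 -> a x -> polyset a (x *: 'X_[m] : {mpoly K[n]}).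
Proof.
by move=> a0 ax k; rewrite mcoeffZ mcoeffX; case: eqP; rewrite ?mulr1 ?mulr0.
Qed.

Lemma polysetM a b c p q : submodule_over (@Rset R) c ->
  (forall x y, a x -> b y -> c (x * y)) ->
  polyset a p -> polyset b q -> polyset c (p * q).
Proof.
move=> cmod abc ap bq m; rewrite mcoeffM.
by apply: submodule_sum cmod _ => k _; apply: abc.
Qed.

Lemma Rset_mul a : submodule_over (@Rset R) a ->
  forall x y, Rset x -> a y -> a (x * y).
Proof. by case. Qed.

End Polysets.

(** * Reduction modulo G and leading term ideals *)

Section PseudoPolynomials.
Variables (R : idomainType) (n : nat) (le : rel 'X_{1..n}).
Local Notation K := {fraction R}.
Local Notation Kx := {mpoly K[n]}.
Variables (I : set Kx) (l : nat) (g : 'I_l -> Kx) (gg : 'I_l -> set K).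
Hypothesis le_order : monomial_order le.
Hypothesis I_ideal : ideal_of (@Rxset n R) I.
Hypothesis gg_mod : forall i, submodule_over (@Rset R) (gg i).
Hypothesis g_neq0 : forall i, g i != 0.
Hypothesis G_sub_I : forall i, pseudo_span (g i) (gg i) `<=` I.
Implicit Types (f h p q : Kx) (ff : set K).

Lemma ideal_sub f h : I f -> I h -> I (f - h).
Proof.
move=> If Ih; case: I_ideal => [[_ ID IM] _]; apply: ID => //.
rewrite -mulN1r -scaleN1r; apply: IM => //; rewrite -mpolyX0.
apply: polysetZX; first exact: Rset0.
by exists (-1); rewrite ?rmorphN ?rmorph1.
Qed.

(** Induction along the chain, adding up the multipliers. A bound on the support of f also bounds
    what a step subtracts, hence the next polynomial; quantifying over all u lets one bound pass
    down the chain. *)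
Lemma reduces_to_repr ff f : reduces_to le g gg ff f 0 ->
  exists h : 'I_l -> Kx,
    [/\ forall i, polyset (fracM (gg i) (fracV ff)) (h i),
        f = \sum_i h i * g i
      & forall u, msupp_le le f u -> forall i, msupp_le le (h i * g i) u].
Proof.
have Fmod i := fracM_submodule (gg i) (fracV ff).
have F0 i : fracM (gg i) (fracV ff) 0 by case: (Fmod i).
(* The end point becomes a variable, as induction on the closure requires. *)
suff H f0 f1 : reduces_to le g gg ff f0 f1 -> f1 = 0 -> exists h : 'I_l -> Kx,
    [/\ forall i, polyset (fracM (gg i) (fracV ff)) (h i),
        f0 = \sum_i h i * g i
      & forall u, msupp_le le f0 u -> forall i, msupp_le le (h i * g i) u].
  by move/H; apply.
elim=> [f2 -> | f2 f3 f4 [f2_0 [a [aF _ def_f3]]] _ IH /IH[h [hF def_h hle]]].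
  exists (fun=> 0); split=> [i m||u _ i]; rewrite ?mcoeff0 ?mul0r //.
    by rewrite big1 // => i _; rewrite mul0r.
  exact: msupp_le0.
pose t i := if divides_lm le g f2 i
  then a i *: 'X_[ldeg le f2 - ldeg le (g i)] else 0.
have t_le u i : msupp_le le f2 u -> msupp_le le (t i * g i) u.
  move=> f2u; rewrite /t; case: ifPn => [di|_]; last first.
    by rewrite mul0r; apply: msupp_le0.
  apply: (@msupp_le_trans _ _ _ _ _ (ldeg le f2)) => //.
    rewrite -{2}(submK di); apply: msupp_leM => //; first exact: msupp_leZX.
    exact: msupp_le_ldeg.
  by apply: f2u; case: (ldegP le_order f2_0).
have def_t : f3 = f2 - \sum_i t i * g i.
  rewrite def_f3 big_mkcond; congr (_ - _); apply: eq_bigr => i _.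
  by rewrite /t; case: ifP; rewrite ?mul0r.
exists (fun i => h i + t i); split=> [i||u f2u i].
- apply: polysetD => //; rewrite /t; case: ifPn => [di|_].
    by apply: polysetZX => //; apply: aF.
  by move=> m; rewrite mcoeff0.
- under eq_bigr do rewrite mulrDl.
  by rewrite big_split /= -def_h def_t subrK.
- rewrite mulrDl; apply: msupp_leD; last exact: t_le.
  apply: hle; rewrite def_t; apply: msupp_leD => //.
  by apply: msupp_leN; apply: msupp_le_sum => j _; apply: t_le.
Qed.

(** For p in ff[x], each p h_i has coefficients in ff (gg_i ff^-1), which is contained in gg_i. *)
Lemma pseudo_span_repr ff f (h : 'I_l -> Kx) :
    (forall i, polyset (fracM (gg i) (fracV ff)) (h i)) ->
  f = \sum_i h i * g i -> pseudo_span f ff `<=` I.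
Proof.
move=> hF -> _ [p pff <-]; rewrite mulr_sumr.
have [Imod _] := I_ideal; apply: submodule_sum Imod _ => i _.
rewrite mulrA; apply: G_sub_I; exists (p * h i) => //.
apply: polysetM pff (hF i) => // x y fx Fy.
exact: fracVM_mul Fy fx.
Qed.

Lemma lt_family_submodule : submodule_over (@Rxset n R) (lt_family le g gg).
Proof.
split=> [|_ _ [q qG <-] [q' qG' <-]|a _ Ra [q qG <-]].
- exists (fun=> 0); last by rewrite big1.
  move=> i; exists 0; rewrite ?mul0r // => m; rewrite mcoeff0.
  by case: (gg_mod i).
- exists (fun i => q i + q' i); last by rewrite big_split.
  move=> i; have [p gp <-] := qG i; have [p' gp' <-] := qG' i.
  by exists (p + p'); rewrite ?mulrDl //; apply: polysetD.
- exists (fun i => a * q i); last by rewrite mulr_sumr.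
  move=> i; have [p gp <-] := qG i.
  exists (a * p); rewrite ?mulrA //.
  by apply: polysetM Ra gp; [|apply: Rset_mul].
Qed.

Lemma lt_family_mem i x : gg i x -> lt_family le g gg (x *: lterm le (g i)).
Proof.
move=> gx; exists (fun j => if j == i then x *: lterm le (g i) else 0).
  move=> j; case: eqP => [->|_].
    exists (x *: 'X_[0]); last by rewrite mpolyX0 -scalerAl mul1r.
    by apply: polysetZX => //; case: (gg_mod i).
  exists 0; rewrite ?mul0r // => m; rewrite mcoeff0.
  by case: (gg_mod j).
by rewrite -big_mkcond big_pred1_eq.
Qed.

(** As lt(g_i) is a single term, p_i lt(g_i) reaches x^u only if lm(g_i) divides x^u, and then
    through one coefficient of p_i. *)
Lemma lt_family_coef f u : lt_family le g gg f ->
  exists2 b : 'I_l -> K, (forall i, gg i (b i)) &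
    f@_u = \sum_(i | (ldeg le (g i) <= u)%MM) b i * lcoef le (g i).
Proof.
move=> [q qG <-]; have /choice[p pG] i : exists p,
    polyset (gg i) p /\ p * lterm le (g i) = q i.
  by case: (qG i) => p; exists p.
exists (fun i => (p i)@_(u - ldeg le (g i))) => [i|]; first exact: (pG i).1.
rewrite raddf_sum [RHS]big_mkcond; apply: eq_bigr => i _ /=.
rewrite -(pG i).2 /lterm -scalerAr mcoeffZ mcoeffMX_if.
by case: ifP; rewrite ?mulr0 // mulrC.
Qed.

Lemma lt_set_submodule (F : set Kx) : submodule_over (@Rxset n R) (lt_set le F).
Proof. exact: submodule_generated. Qed.

Lemma lt_set_mem (F : set Kx) f : F f -> f != 0 -> lt_set le F (lterm le f).
Proof. by move=> Ff f0; apply: sub_gen_smallest; exists f. Qed.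

Lemma pseudo_span_mem ff f x : ff 0 -> ff x -> pseudo_span f ff (x *: f).
Proof.
move=> ff0 fx; exists (x *: 'X_[0]); first exact: polysetZX.
by rewrite mpolyX0 -scalerAl mul1r.
Qed.

(* The invertibility of ff turns the inclusion of ff lc(f) in the sum of the
   gg_i lc(g_i) into coefficients for lc(f). *)
Lemma lcoef_reducible ff f :
    fracM ff (fracV ff) 1 -> submodule_over (@Rset R) ff ->
    lt_set le I `<=` lt_family le g gg -> f != 0 -> pseudo_span f ff `<=` I ->
  exists2 a : 'I_l -> K, (forall i, fracM (gg i) (fracV ff) (a i)) &
    lcoef le f = \sum_(i | divides_lm le g f i) a i * lcoef le (g i).
Proof.
move=> ff1 ffmod ltI f0 fI.
(* [Z] is an R-submodule of K; it suffices that it contains x y for x in ff and y in ff^-1, since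
   then it contains 1. *)
pose Z := [set z | exists2 a : 'I_l -> K,
  (forall i, fracM (gg i) (fracV ff) (a i)) &
  z * lcoef le f = \sum_(i | divides_lm le g f i) a i * lcoef le (g i)].
suff /(_ _ ff1)[a aF def_a] : fracM ff (fracV ff) `<=` Z.
  by exists a; rewrite // -def_a mul1r.
have Fmod i := fracM_submodule (gg i) (fracV ff).
apply: fracM_sub => [|x y fx Vy].
  split=> [|z z' [a aF az] [a' aF' az']|r z Rr [a aF az]].
  - exists (fun=> 0) => [i|]; first by case: (Fmod i).
    by rewrite mul0r big1 // => i _; rewrite mul0r.
  - exists (fun i => a i + a' i) => [i|].
      by case: (Fmod i) => _ FD _; apply: FD.
    by rewrite mulrDl az az' -big_split; apply: eq_bigr => i _; rewrite mulrDl.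
  - exists (fun i => r * a i) => [i|].
      by case: (Fmod i) => _ _ FM; apply: FM.
    by rewrite -mulrA az mulr_sumr; apply: eq_bigr => i _; rewrite mulrA.
(* For x != 0 this is lt(x f), with x f in I. *)
have xfI : lt_family le g gg (x *: lterm le f).
  have [->|x0] := eqVneq x 0.
    by rewrite scale0r; case: lt_family_submodule.
  rewrite -ltermZ //; apply: ltI; apply: lt_set_mem.
    by apply/fI/pseudo_span_mem => //; case: ffmod.
  by rewrite scaler_eq0 negb_or x0.
have [b bg def_b] := lt_family_coef (ldeg le f) xfI.
exists (fun i => b i * y) => [i|]; first exact: fracM_mem.
move: def_b; rewrite !mcoeffZ mcoeffX eqxx mulr1 => xlc.
rewrite mulrAC xlc mulr_suml; apply: eq_bigr => i _.
by rewrite mulrAC.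
Qed.

(** Well-founded induction on the leading exponent: a step cancels the leading term and keeps the
    span in I. *)
Lemma reduces_to0 ff f :
    fracM ff (fracV ff) 1 -> submodule_over (@Rset R) ff ->
    lt_set le I `<=` lt_family le g gg -> pseudo_span f ff `<=` I ->
  reduces_to le g gg ff f 0.
Proof.
move=> ff1 ffmod ltI; have [_ _ _ le_wf _] := le_order.
move: {2}(ldeg le f) (erefl (ldeg le f)) => u; move: u f.
apply: (well_founded_ind le_wf) => u IH f def_u fI.
have [->|f0] := eqVneq f 0; first exact: rt1n_refl.
have [a aF lcf] := lcoef_reducible ff1 ffmod ltI f0 fI.
pose t i := a i *: 'X_[ldeg le f - ldeg le (g i)] : Kx.
pose f1 := f - \sum_(i | divides_lm le g f i) t i * g i.
have red : one_step_reduction le g gg ff f f1.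
  by split=> //; exists a; split.
have f1I : pseudo_span f1 ff `<=` I.
  move=> _ [p pf <-]; rewrite mulrBr; apply: ideal_sub.
    by apply: fI; exists p.
  rewrite mulr_sumr; have [Imod _] := I_ideal.
  apply: submodule_sum Imod _ => i _; rewrite mulrA.
  apply: G_sub_I; exists (p * t i) => //.
  have tF : polyset (fracM (gg i) (fracV ff)) (t i).
    apply: polysetZX; last exact: aF.
    by case: (fracM_submodule (gg i) (fracV ff)).
  apply: polysetM pf tF => // x y fx Fy; exact: fracVM_mul Fy fx.
(* The case of 0 is apart: its default [ldeg] is not strictly below that of a non-zero constant
   f. *)
have [f1_0|f1_0] := eqVneq f1 0.
  by apply: rt1n_trans red _; rewrite f1_0; apply: rt1n_refl.
apply: rt1n_trans red _; apply: IH (erefl _) f1I.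
have tsupp i : msupp_le le (t i) (ldeg le f - ldeg le (g i))%MM.
  exact: msupp_leZX.
have f1_le : msupp_le le f1 u.
  rewrite -def_u; apply: msupp_leD; first exact: msupp_le_ldeg.
  apply: msupp_leN; apply: msupp_le_sum => i di.
  rewrite -(submK di); apply: msupp_leM => //.
  exact: msupp_le_ldeg.
(* At u the i-th summand has coefficient a_i lc(g_i), and these add up to lc(f). *)
have f1u : f1@_u = 0.
  rewrite mcoeffB raddf_sum /= -def_u -/(lcoef le f) lcf; apply/eqP.
  rewrite subr_eq0; apply/eqP/eq_bigr => i di.
  rewrite -{1}(submK di) (mcoeffM_top le_order (tsupp i)); last first.
    exact: msupp_le_ldeg.
  by rewrite /t mcoeffZ mcoeffX eqxx mulr1.
have [f1s _] := ldegP le_order f1_0; rewrite f1_le //=.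
by apply: contraTneq f1s => ->; rewrite mcoeff_msupp f1u eqxx.
Qed.

Lemma repr_ldeg ff f : f != 0 -> reduces_to le g gg ff f 0 ->
  exists h : 'I_l -> Kx,
    [/\ forall i, polyset (fracM (gg i) (fracV ff)) (h i),
        f = \sum_i h i * g i,
        exists2 i, h i != 0 & ldeg le f = ldeg le (h i * g i)
      & forall i, h i != 0 -> le (ldeg le (h i * g i)) (ldeg le f)].
Proof.
move=> f0 /reduces_to_repr[h [hF def_f hle]]; exists h.
have h_le := hle _ (@msupp_le_ldeg _ _ _ le_order f).
split=> // [|i h0]; last first.
  by apply: (h_le i); case: (ldegP le_order (mulf_neq0 h0 (g_neq0 i))).
have coef_f u : f@_u = \sum_i (h i * g i)@_u by rewrite def_f raddf_sum.
(* The maximum is attained: the coefficient of f at its leading exponent is not 0, so some h_i g_i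
   has a non-zero coefficient there. *)
have [i hgi] : exists i, (h i * g i)@_(ldeg le f) != 0.
  apply: contrapT => nh; have := lcoef_neq0 le_order f0.
  rewrite /lcoef coef_f big1 ?eqxx // => i _.
  by apply/eqP/negPn/negP => hi; apply: nh; exists i.
exists i; last by rewrite (ldeg_eq le_order hgi).
by apply: contraNneq hgi => ->; rewrite mul0r mcoeff0.
Qed.

(** The admissible x form an R-submodule of K, so it suffices to treat generators c of gg_i; for c
    != 0 the term c lt(g_i) is lt(c g_i). *)
Lemma lt_setZX (F : set Kx) i (s : seq K) x m :
    gg i = generated_over (@Rset R) [set` s] ->
    (forall c, c \in s -> F (c *: g i)) -> gg i x ->
  lt_set le F (x *: 'X_[m] * lterm le (g i)).
Proof.
move=> -> sF; have [F0 FD FM] := lt_set_submodule F; move: x.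
apply: (@smallest_sub _ _ _
  [set x | lt_set le F (x *: 'X_[m] * lterm le (g i))]).
  split=> [|x y Fx Fy|c x Rc Fx] /=.
  - by rewrite scale0r mul0r.
  - by rewrite scalerDl mulrDl; apply: FD.
  - rewrite -scalerA -scalerAl -[_ *: (_ * _)]mul1r -scalerAr scalerAl.
    by apply: FM => //; rewrite -mpolyX0; apply: polysetZX => //; apply: Rset0.
move=> c /= cs; have [->|c0] := eqVneq c 0; first by rewrite scale0r mul0r.
rewrite -scalerAl scalerAr -ltermZ //; apply: FM.
  by rewrite -['X_[m]]scale1r; apply: polysetZX; [apply: Rset0|apply: Rset1].
by apply: lt_set_mem; [apply: sF|rewrite scaler_eq0 negb_or c0 g_neq0].
Qed.

(** This makes (iii) applicable to every non-zero polynomial of I, through the pair (f, R). *)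
Lemma pseudo_poly_Rset f : I f ->
  pseudo_poly f (@Rset R) /\ pseudo_span f (@Rset R) `<=` I.
Proof.
move=> If; have [[I0 ID IM] IR] := I_ideal.
have fI : pseudo_span f (@Rset R) `<=` I by move=> _ [p Rp <-]; apply: IM.
split=> //; split=> [|c Rc]; first exact: fractional_Rset.
by apply/IR/fI/pseudo_span_mem => //; apply: Rset0.
Qed.

End PseudoPolynomials.

(** * The cycle of implications (i) => (ii) => (iii) => (iv) => (i) *)

Theorem theorem3p12 (R : idomainType) (n : nat) (le : rel 'X_{1..n})
    (I : set {mpoly {fraction R}[n]}) (l : nat)
    (g : 'I_l -> {mpoly {fraction R}[n]}) (gg : 'I_l -> set {fraction R})
    (R_dedekind : dedekind R)
    (le_order : monomial_order le)
    (I_ideal : ideal_of (@Rxset n R) I)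
    (G_pseudo : forall i, pseudo_poly (g i) (gg i))
    (G_neq0 : forall i, g i != 0)
    (G_sub_I : forall i, pseudo_span (g i) (gg i) `<=` I) :
  [<-> lt_set le I = lt_family le g gg;

       forall (f : {mpoly {fraction R}[n]}) (ff : set {fraction R}),
         pseudo_poly f ff ->
         (pseudo_span f ff `<=` I <-> reduces_to le g gg ff f 0);

       forall (f : {mpoly {fraction R}[n]}) (ff : set {fraction R}),
         pseudo_poly f ff -> f != 0 -> pseudo_span f ff `<=` I ->
         exists h : 'I_l -> {mpoly {fraction R}[n]},
           [/\ forall i, polyset (fracM (gg i) (fracV ff)) (h i),
               f = \sum_i h i * g i,
               exists2 i, h i != 0 & ldeg le f = ldeg le (h i * g i)
             & forall i, h i != 0 -> le (ldeg le (h i * g i)) (ldeg le f)];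

       forall a : 'I_l -> seq {fraction R},
         (forall i, gg i = generated_over (@Rset R) [set` a i]) ->
         groebner_basis le I
           [set p | exists i, exists2 c, c \in a i & p = c *: g i]].
Proof.
have gg_mod i : submodule_over (@Rset R) (gg i).
  by apply: fractional_submodule; case: (G_pseudo i).
have gg0 i : gg i 0 by case: (gg_mod i).
tfae.
(* (i) => (ii): reduction to 0 yields cofactors, which place the span in I; the other direction
   rests on the invertibility of ff. *)
- move=> ltI f ff [frac _]; split=> [fI|]; last first.
    case/(reduces_to_repr le_order) => h [hF def_f _].
    exact: pseudo_span_repr I_ideal gg_mod G_sub_I _ _ _ hF def_f.
  apply: (reduces_to0 le_order I_ideal) fI => //; last by rewrite ltI.
    exact: dedekind_invertible.
  exact: fractional_submodule.
- move=> red f ff f_pseudo f0 /(red _ _ f_pseudo).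
  exact: repr_ldeg.
- move=> repr a gen_a.
  set F := [set p | _].
  have FI : F `<=` I.
    move=> _ [i [c ca ->]]; apply: (G_sub_I i); apply: pseudo_span_mem => //.
    by rewrite gen_a; apply: sub_gen_smallest.
  split=> //.
    apply: (@sub_finite_set _ _
      [set` [seq c *: g i | i <- enum 'I_l, c <- a i]]); last exact: finite_seq.
    move=> _ [i [c ca ->]]; apply/allpairsPdep; exists i, c.
    by rewrite mem_enum.
  apply/seteqP; split.
    apply: sub_smallest2r; first exact: submodule_generated.
    by move=> _ [f [/FI If f0] <-]; exists f.
  apply: smallest_sub; first exact: submodule_generated.
  move=> _ [f [If f0] <-].
  have [f_pseudo fI] := pseudo_poly_Rset I_ideal If.
  have [h [hF def_f _ h_le]] := repr _ _ f_pseudo f0 fI.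
  (* lt(f) is the sum of the terms of the h_i g_i at the leading exponent of f, each a multiple of
     lt(g_i) by an element of gg_i times a monomial. *)
  have coef_f u : f@_u = \sum_i (h i * g i)@_u by rewrite def_f raddf_sum.
  rewrite /lterm /lcoef coef_f scaler_suml.
  apply: (submodule_sum _ (lt_set_submodule le F)) => i _.
  have hg m : gg i (h i)@_m by apply: fracM_fracV_Rset (hF i m).
  have hgf : msupp_le le (h i * g i) (ldeg le f).
    have [->|hi0] := eqVneq (h i) 0; first by rewrite mul0r; apply: msupp_le0.
    apply: (msupp_le_trans le_order _ (h_le i hi0)).
    exact: msupp_le_ldeg.
  have [c [e gc ->]] := top_termM le_order (G_neq0 i) (gg0 i) hg hgf.
  apply: lt_setZX (gen_a i) _ gc => // x xa.
  by exists i, x.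
- move=> gb.
  have /choice[a gen_a] i :
      exists s : seq {fraction R}, gg i = generated_over (@Rset R) [set` s].
    by case: (G_pseudo i) => [[_ [s ->]] _]; exists s.
  have [_ _ <-] := gb a gen_a; apply/seteqP; split.
    apply: smallest_sub; first exact: lt_family_submodule.
    move=> _ [_ [[i [c ca ->]] cg0] <-].
    rewrite ltermZ //; last by apply: contraNneq cg0 => ->; rewrite scale0r.
    apply: lt_family_mem => //.
    by rewrite gen_a; apply: sub_gen_smallest.
  move=> _ [q qG <-]; apply: (submodule_sum _ (lt_set_submodule le _)) => i _.
  (* Split into terms, p has each coefficient in gg_i, so every term times lt(g_i) is in the
     ideal. *)
  have [p pg <-] := qG i; rewrite [p]mpolyE mulr_suml.
  apply: (submodule_sum _ (lt_set_submodule le _)) => m _.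
  apply: lt_setZX (gen_a i) _ _ => //.
  by move=> c ca; exists i, c.
Qed.
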